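(* Let $\epsilon\in(0,\gamma]$ and let $u^\epsilon$ be the value of the $\epsilon$-obstacle tug-of-war game. Then for every $x\in\Omega$, $$0\le u^\epsilon(x)-\frac12\left(\sup_{B_\epsilon(x)}u^\epsilon+\inf_{B_\epsilon(x)}u^\epsilon\right)\le\left[\Psi(x)-\frac12\left(\sup_{B_\epsilon(x)}\Psi+\inf_{B_\epsilon(x)}\Psi\right)\right]_+,$$ where $[a]_+=\max\{a,0\}$.
   Context: Setting. $\Omega\subset\mathbb R^N$ is a bounded smooth domain, $\gamma>0$ is fixed, and $\Gamma=\{x\in\mathbb R^N\setminus\Omega:\operatorname{dist}(x,\partial\Omega)\le\gamma\}$. The final payoff $F:\Gamma\to\mathbb R$ is Lipschitz, and the obstacle $\Psi:\mathbb R^N\to\mathbb R$ is Lipschitz with $\Psi\le F$ in $\Gamma$. $B_\epsilon(x)$ is the ball of radius $\epsilon$ centered at $x$. The $\epsilon$-obstacle tug-of-war game ($0<\epsilon\le\gamma$). A token starts at $x_0$. If $x_0\in\Gamma$ the game ends at once. At each stage $k$ with $x_k\in\Omega$, Player I may end the game; otherwise each player $i\in\{I,II\}$ chooses an action $a_k^i\in B_\epsilon(x_k)$, a fair coin is tossed, and $x_{k+1}=a_k^I$ or $x_{k+1}=a_k^{II}$ with probability $1/2$ each. The game also ends when the token reaches $\Gamma$. When the game ends at position $x_\tau$, Player II pays Player I the amount $\tilde F(x_\tau)$, where $\tilde F=F$ on $\Gamma$ and $\tilde F=\Psi$ on $\Omega$. A strategy $S_i$ of Player $i$ is a sequence of Borel-measurable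 maps sending each history $(x_0,a_0,x_1,\dots,a_{k-1},x_k)$ (where $a_j=(a_j^I,a_j^{II})$) to a point of $B_\epsilon(x_k)$. A stopping rule $\tau$ for Player I is a finite, Borel-measurable stopping time with values in $\mathbb N=\{0,1,2,\dots\}$ with respect to the histories ($\tau=k$ means that Player I ends the game at stage $k$, if it has not ended already). These data induce a probability on plays with expectation $\mathbb E^{x_0}_{\tau,S_I,S_{II}}$. Let $V_{x_0,I}(\tau,S_I,S_{II})=V_{x_0,II}(\tau,S_I,S_{II})=\mathbb E^{x_0}_{\tau,S_I,S_{II}}[\tilde F(x_\tau)]$ ($x_\tau$ the terminal position) if the game terminates almost surely, and otherwise $V_{x_0,I}=-\infty$, $V_{x_0,II}=+\infty$. The values for the two players are $$u_I^\epsilon(x_0)=\sup_{\tau,S_I}\inf_{S_{II}}V_{x_0,I}(\tau,S_I,S_{II}),\qquad u_{II}^\epsilon(x_0)=\inf_{S_{II}}\sup_{\tau,S_I}V_{x_0,II}(\tau,S_I,S_{II}),$$ and the value of the game is the common function $u^\epsilon=u_I^\epsilon=u_{II}^\epsilon$ on $\Omega\cup\Gamma$ (the two coincide). *)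

(* Defs.v *)
From HB Require Import structures.
From mathcomp Require Import all_boot all_order all_algebra.
From mathcomp Require Import all_classical all_reals all_analysis.
Set Implicit Arguments.
Unset Strict Implicit.
Unset Printing Implicit Defensive.
Import Order.TTheory GRing.Theory Num.Theory.
Import numFieldNormedType.Exports.
Local Open Scope classical_set_scope.
Local Open Scope ring_scope.

Section Euclidean.
Context {R : realType} {N : nat}.
Implicit Types (x y : 'rV[R]_N) (A : set 'rV[R]_N).

(* The library norm on row vectors is the sup norm; the metric notions below
   are the Euclidean ones.  The two norms induce the same topology, so [open],
   [closure], [connected] and the Borel sets are those of the library. *)
Definition enorm x : R := Num.sqrt (\sum_i x 0 i ^+ 2).

Definition eball x (r : R) : set 'rV[R]_N := [set y | enorm (y - x) < r].

Definition edistance x A : R := inf [set enorm (x - y) | y in A].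

Definition boundary A : set 'rV[R]_N := closure A `\` interior A.

Definition lipschitz_in A (f : 'rV[R]_N -> R) : Prop :=
  exists L : R, forall x y, A x -> A y -> `|f x - f y| <= L * enorm (x - y).

Fixpoint iter_partial (s : seq 'I_N) (f : 'rV[R]_N -> R) : 'rV[R]_N -> R :=
  if s is i :: s' then fun x => 'D_(delta_mx 0 i) (iter_partial s' f) x else f.

Definition smooth (f : 'rV[R]_N -> R) : Prop :=
  forall s : seq 'I_N, continuous (iter_partial s f) /\
    forall (i : 'I_N) x, derivable (iter_partial s f) x (delta_mx 0 i).

End Euclidean.

Section Domain.
Context {R : realType} {N : nat}.

(* Near each boundary point, A lies strictly on one side of the graph of a
   C^oo function of all the coordinates but the i-th; b is the orientation of
   the i-th axis. *)
Definition smooth_boundary (A : set 'rV[R]_N) : Prop :=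
  forall p, boundary A p ->
    exists (i : 'I_N) (b : bool) (g : 'rV[R]_N.-1 -> R) (r : R),
      [/\ smooth g, 0 < r & forall y, eball p r y ->
          (A y <-> g (col' i y) < (-1) ^+ b * y 0 i)].

Definition bounded_smooth_domain (A : set 'rV[R]_N) : Prop :=
  [/\ open A, connected A, A !=set0, bounded_set A & smooth_boundary A].

Definition outer_strip (Om : set 'rV[R]_N) (gamma : R) : set 'rV[R]_N :=
  [set x | ~ Om x /\ edistance x (boundary Om) <= gamma].

End Domain.

(* Fair independent coin tosses: each finite sequence of n outcomes has
   probability 2^-n. *)
Definition fair_coins {R : realType} d (T : measurableType d)
    (P : probability T R) (coin : nat -> T -> bool) : Prop :=
  (forall k, measurable_fun setT (coin k)) /\
  forall n (b : n.-tuple bool),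
    P [set t | forall i : 'I_n, coin i t = tnth b i] = (2 ^- n)%:E.

(* R^N with its Borel sigma-algebra. *)
Notation position R N := (g_sigma_algebraType (@open 'rV[R]_N)).

(* A stage consists of the position x_k and the pair of actions
   (a_k^I, a_k^II); a history at stage k consists of the k previous stages and
   of the current position x_k. *)
Notation stage R N := (position R N * (position R N * position R N))%type.
Notation history R N k := (k.-tuple (stage R N) * position R N)%type.

Section Game.
Context {R : realType} {N : nat}.

(* Plays are continued formally after the end of the game, which is given by
   [ends_at] below; what happens after the end does not affect the payoff. *)
Definition play : Type := nat -> stage R N.

Definition history_of (k : nat) (w : play) : history R N k :=
  ([tuple w i | i < k], (w k).1).

Definition policy : Type := forall k, history R N k -> position R N.

Definition strategy (eps : R) : set policy :=
  [set S : policy | forall k, measurable_fun setT (S k) /\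
       forall h : history R N k, eball h.2 eps (S k h)].

Definition stopping_rule : set (play -> nat) :=
  [set tau : play -> nat | forall k,
       exists2 A : set (history R N k), measurable A &
       [set w | tau w = k] = history_of k @^-1` A].

(* The history reached at stage k from x0 when the outcomes of the tosses are
   given by c: true moves the token to the action of Player I. *)
Fixpoint run (SI SII : policy) (x0 : position R N) (c : nat -> bool) (k : nat)
    : history R N k :=
  if k is k'.+1 then
    let h := run SI SII x0 c k' in
    let a := (SI k' h, SII k' h) in
    (rcons_tuple h.1 (h.2, a), if c k' then a.1 else a.2)
  else ([tuple], x0).

Definition run_play (SI SII : policy) (x0 : position R N) (c : nat -> bool)
    : play :=
  fun k => let h := run SI SII x0 c k in (h.2, (SI k h, SII k h)).

Variables (Om : set 'rV[R]_N) (gamma eps : R) (F Psi : 'rV[R]_N -> R).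

Definition payoff (x : 'rV[R]_N) : R := if x \in Om then Psi x else F x.

Definition ends_at (tau : play -> nat) (w : play) (k : nat) : Prop :=
  outer_strip Om gamma (w k).1 \/ tau w = k.

Definition terminates (tau : play -> nat) (w : play) : Prop :=
  exists k, ends_at tau w k.

(* The least k at which the game ends, 0 if it does not terminate. *)
Definition end_time (tau : play -> nat) (w : play) : nat :=
  xget 0%N [set k | ends_at tau w k /\
                    forall j, (j < k)%N -> ~ ends_at tau w j].

Definition terminal_position (tau : play -> nat) (w : play) : 'rV[R]_N :=
  (w (end_time tau w)).1.

Context d (T : measurableType d).
Variables (P : probability T R) (coin : nat -> T -> bool).

Definition random_play (SI SII : policy) (x0 : 'rV[R]_N) (t : T) : play :=
  run_play SI SII x0 (coin ^~ t).

(* The expected payoff, with the value v if the game does not terminate almost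
   surely. *)
Definition expected_payoff (v : \bar R) (x0 : 'rV[R]_N) (tau : play -> nat)
    (SI SII : policy) : \bar R :=
  if `[< {ae P, forall t, terminates tau (random_play SI SII x0 t)} >]
  then ('E_P[fun t =>
          payoff (terminal_position tau (random_play SI SII x0 t))])%E
  else v.

Definition VI := expected_payoff -oo%E.
Definition VII := expected_payoff +oo%E.

Definition value_I (x0 : 'rV[R]_N) : \bar R :=
  ereal_sup [set ereal_inf [set VI x0 p.1 p.2 SII | SII in strategy eps]
            | p in stopping_rule `*` strategy eps].

Definition value_II (x0 : 'rV[R]_N) : \bar R :=
  ereal_inf [set ereal_sup [set VII x0 p.1 p.2 SII
                           | p in stopping_rule `*` strategy eps]
            | SII in strategy eps].

Definition game_value (u : 'rV[R]_N -> R) : Prop :=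
  forall x, (Om `|` outer_strip Om gamma) x ->
    value_I x = (u x)%:E /\ value_II x = (u x)%:E.

End Game.

(* Main.v *)
Require Import Defs.
From mathcomp Require Import all_boot all_order all_algebra.
From mathcomp Require Import all_classical all_reals all_analysis.
From mathcomp Require Import measurable_realfun lra.
Set Implicit Arguments.
Unset Strict Implicit.
Unset Printing Implicit Defensive.
Import Order.TTheory GRing.Theory Num.Theory.
Import numFieldNormedType.Exports.
Local Open Scope classical_set_scope.
Local Open Scope ring_scope.

(** The two estimates are the dynamic programming principle
    u = max (Psi, mean of the sup and the inf of u over the ball), read off from
    the two definitions of the value.

    The lower estimate u >= (sup u + inf u) / 2 comes from the upper value
    inf_SII sup_(tau,SI).  Once the strategy of Player II is given, her first
    action z at x is a known point; Player I aims at a point y where u is nearly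
    maximal, and after the toss he plays almost optimally, from whichever of y
    and z was reached, against the remainder of the given strategy
    ([value_ge_mean]).  The upper estimate u <= max (Psi, (sup u + inf u) / 2)
    comes symmetrically from the lower value sup_(tau,SI) inf_SII
    ([value_le_mean]): if the stopping rule does not stop at x, then Player II
    answers with a point z where u is nearly minimal and with almost optimal
    continuations at y and z.  In both cases the opponent is fixed first, so
    that only two continuations have to be glued: the glued strategy is Borel
    because points are closed, and no measurable selection of almost optimal
    strategies over the whole ball is involved.  It is the equality of the two
    values that makes both estimates available for the same function u.

    Both arguments rest on one identity ([expected_payoff_first_stage]): the
    expected payoff from x is the mean of the expected payoffs of the
    continuations from y and z.  It holds because deleting the first toss of a
    sequence of fair coins leaves a sequence of fair coins ([integral_coin_cons]),
    first for functions of finitely many tosses and then, by dominated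
    convergence, for the payoff, which is a limit of such functions.  The
    conventions -oo and +oo for plays that may go on forever are compatible with
    the mean, since the game from x terminates almost surely if and only if both
    continuations do.

    Finally u >= Psi, because Player I may stop at once ([payoff_le_value]).  So
    where u(x) exceeds the mean of its sup and inf, it equals Psi(x) there, and
    replacing u by the smaller Psi in the sup and the inf can only increase the
    difference: this gives the second inequality of the theorem. *)

(** * Fair coins *)

Definition coin_cons (b : bool) (c : nat -> bool) : nat -> bool :=
  fun k => if k is k'.+1 then c k' else b.

Definition depends_on_first {V : Type} (n : nat) (f : (nat -> bool) -> V) :=
  forall c c' : nat -> bool, (forall i, (i < n)%N -> c i = c' i) -> f c = f c'.

(** The random variables of a game that ends in finite time: the payoff is known
    once the game is over, and the approximations are its truncations.  The
    uniform bound is there for dominated convergence. *)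
Definition finitely_approximable {R : realType} (f : (nat -> bool) -> R) :=
  exists (M : R) (fn : nat -> (nat -> bool) -> R),
    [/\ forall n, depends_on_first n (fn n),
        forall n c, `|fn n c| <= M
      & forall c, fn n c @[n --> \oo] --> f c].

Lemma depends_on_first_cons {V : Type} n (f : (nat -> bool) -> V) b :
  depends_on_first n.+1 f -> depends_on_first n (f \o coin_cons b).
Proof. by move=> fn c c' cc'; apply: fn => -[|i] //=; exact: cc'. Qed.

Lemma sum_tuple_cons (V : nmodType) n (g : (nat -> bool) -> V) :
  \sum_(b : n.+1.-tuple bool) g (nth false b) =
  \sum_(b : n.-tuple bool) g (coin_cons true (nth false b)) +
  \sum_(b : n.-tuple bool) g (coin_cons false (nth false b)).
Proof.
transitivity (\sum_(p : bool * n.-tuple bool) g (coin_cons p.1 (nth false p.2))).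
  rewrite (reindex (fun p : bool * n.-tuple bool => cons_tuple p.1 p.2)).
    by apply: eq_bigr => -[b s] _; congr g; apply/funext => -[].
  exists (fun s : n.+1.-tuple bool => (thead s, behead_tuple s)).
    by move=> [b s] _ /=; congr (_, _); apply: val_inj.
  by move=> s _; rewrite [RHS]tuple_eta; apply: val_inj.
rewrite -(pair_bigA _ (fun b s => g (coin_cons b (nth false (val s))))) /=.
by rewrite big_bool.
Qed.

Section FairCoins.
Context {R : realType} {d} {T : measurableType d} (P : probability T R).
Context (coin : nat -> T -> bool) (fair : fair_coins P coin).
Implicit Type f : (nat -> bool) -> R.

Let cylinder n (b : n.-tuple bool) : set T :=
  [set t | forall i : 'I_n, coin i t = tnth b i].

Let measurable_cylinder n (b : n.-tuple bool) : measurable (cylinder b).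
Proof.
rewrite (_ : cylinder b =
    \bigcap_(i in [set: 'I_n]) (coin i @^-1` [set tnth b i])); last first.
  by apply/seteqP; split=> t /= H i => [_|]; exact: H.
apply: fin_bigcap_measurable => // i _; rewrite -[X in measurable X]setTI.
by apply: (fair.1 i).
Qed.

Let cylinder_expansion n f : depends_on_first n f -> forall t,
  f (coin ^~ t) = \sum_(b : n.-tuple bool) f (nth false b) * \1_(cylinder b) t.
Proof.
move=> fn t; rewrite (bigD1 [tuple coin i t | i < n]) //= big1 ?addr0.
  rewrite indicE mem_set ?mulr1; last by move=> i /=; rewrite tnth_mktuple.
  apply: fn => i i_n; rewrite -[LHS](tnth_mktuple (fun j : 'I_n => coin j t)
    (Ordinal i_n)) (tnth_nth false).
  by [].
move=> b /eqP bt; rewrite indicE memNset ?mulr0// => cb; apply: bt.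
by apply/eq_from_tnth => i; rewrite tnth_mktuple -cb.
Qed.

Lemma measurable_depends_on_first n f : depends_on_first n f ->
  measurable_fun setT (fun t => f (coin ^~ t)).
Proof.
move=> fn; rewrite (_ : (fun _ => _) = fun t =>
  \sum_(b : n.-tuple bool) f (nth false b) * \1_(cylinder b) t).
  apply: measurable_sum => b; apply: measurable_funM; first exact: measurable_cst.
  exact: (measurable_indic (measurable_cylinder b)).
by apply/funext => t; exact: cylinder_expansion.
Qed.

Lemma integral_depends_on_first n f : depends_on_first n f ->
  (\int[P]_t (f (coin ^~ t))%:E)%E =
    (2 ^- n * \sum_(b : n.-tuple bool) f (nth false b))%:E.
Proof.
move=> fn; under eq_integral do rewrite (cylinder_expansion fn) -sumEFin.
have i1 b : P.-integrable setT (EFin \o \1_(cylinder b)).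
  by apply: integrable_indic.
rewrite integral_sum //; last first.
  move=> b; rewrite (_ : (fun _ => _) = fun t =>
    ((f (nth false b))%:E * (EFin \o \1_(cylinder b)) t)%E) //.
  exact: integrableZl.
rewrite mulr_sumr -sumEFin; apply: eq_bigr => b _.
under eq_integral do rewrite EFinM.
rewrite integralZl//; last exact: i1.
rewrite integral_indic// setIT [in RHS]mulrC EFinM; congr (_ * _)%E.
exact: (fair.2 n b).
Qed.

Lemma finitely_approximable_coin_cons b f :
  finitely_approximable f -> finitely_approximable (f \o coin_cons b).
Proof.
move=> [M [fn [fnd fnM fnf]]]; exists M, (fun n => fn n.+1 \o coin_cons b).
split=> [n|n c|c]; first exact: depends_on_first_cons.
  exact: fnM.
by rewrite (cvg_shiftS (fun n => fn n (coin_cons b c))).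
Qed.

Lemma measurable_finitely_approximable f : finitely_approximable f ->
  measurable_fun setT (fun t => f (coin ^~ t)).
Proof.
move=> [M [fn [fnd fnM fnf]]].
apply: (measurable_fun_cvg (h := fun n t => fn n (coin ^~ t))).
  by move=> n; exact: measurable_depends_on_first.
by move=> t _; exact: fnf.
Qed.

Lemma integrable_finitely_approximable f : finitely_approximable f ->
  P.-integrable setT (fun t => (f (coin ^~ t))%:E).
Proof.
move=> af; have [M [fn [fnd fnM fnf]]] := af.
apply: measurable_bounded_integrable => //.
- by rewrite (le_lt_trans (probability_le1 _ _)) ?ltry.
- exact: measurable_finitely_approximable.
exists M; split; first by rewrite num_real.
move=> x Mx t _ /=; rewrite (le_trans _ (ltW Mx))//.
have : `|fn n (coin^~ t)| @[n --> \oo] --> `|f (coin^~ t)| by apply: cvg_norm.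
move=> cv; rewrite -(cvg_lim _ cv)//; apply: limr_le; first exact: cvgP cv.
exact: nearW.
Qed.

Lemma cvg_integral_depends_on_first (M : R) f fn :
  (forall n, exists m, depends_on_first m (fn n)) ->
  (forall n c, `|fn n c| <= M) ->
  (forall c, fn n c @[n --> \oo] --> f c) ->
  (\int[P]_t (fn n (coin ^~ t))%:E @[n --> \oo] -->
   \int[P]_t (f (coin ^~ t))%:E)%E.
Proof.
move=> fnd fnM fnf.
have mfn n : measurable_fun setT (fun t => fn n (coin ^~ t)).
  by have [m fm] := fnd n; exact: measurable_depends_on_first fm.
have mf : measurable_fun setT (fun t => f (coin ^~ t)).
  apply: (measurable_fun_cvg (h := fun n t => fn n (coin ^~ t))) => //.
have [] := @dominated_convergence _ _ _ P setT measurableT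
  (fun n t => (fn n (coin ^~ t))%:E) (fun t => (f (coin ^~ t))%:E) (cst M%:E).
- by move=> n; apply/measurable_EFinP.
- by apply/measurable_EFinP.
- by apply: aeW => t _; apply: cvg_EFin => //; [exact: nearW|exact: fnf].
- by apply: finite_measure_integrable_cst.
- by apply: aeW => t n _; rewrite /= lee_fin.
- by [].
Qed.

(** Conditioning on the first toss: the remaining tosses have the same law as
    the whole sequence.  For a function of n + 1 tosses both sides are finite
    sums over the outcomes; the general case follows by passing to the limit. *)
Lemma integral_coin_cons f : finitely_approximable f ->
  (\int[P]_t (f (coin ^~ t))%:E =
   2^-1%:E * (\int[P]_t (f (coin_cons true (coin ^~ t)))%:E +
              \int[P]_t (f (coin_cons false (coin ^~ t)))%:E))%E.
Proof.
move=> af; have [M [fn [fnd fnM fnf]]] := af.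
have afb b := finitely_approximable_coin_cons b af.
pose I g := (\int[P]_t (g (coin ^~ t) : R)%:E)%E.
have fin g : finitely_approximable g -> I g \is a fin_num.
  by move=> ag; apply: integrable_fin_num => //; exact: integrable_finitely_approximable.
have stepn n : I (fn n.+1) =
    (2^-1%:E * (I (fn n.+1 \o coin_cons true) + I (fn n.+1 \o coin_cons false)))%E.
  rewrite /I (integral_depends_on_first (fnd n.+1)).
  rewrite !(integral_depends_on_first (depends_on_first_cons _ (fnd n.+1))).
  rewrite -EFinD -EFinM sum_tuple_cons exprS invfM -!mulrA.
  by congr (_ * _)%:E; rewrite mulrDr.
have cvgI b : I (fn n.+1 \o coin_cons b) @[n --> \oo] --> I (f \o coin_cons b).
  apply: (cvg_integral_depends_on_first (M := M)
    (fn := fun n => fn n.+1 \o coin_cons b)) => [n|n c|c].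
  - by exists n; exact: depends_on_first_cons.
  - exact: fnM.
  by rewrite (cvg_shiftS (fun n => fn n (coin_cons b c))).
have cvg1 : I (fn n.+1) @[n --> \oo] --> I f.
  rewrite (cvg_shiftS (I \o fn)).
  by apply: (cvg_integral_depends_on_first (M := M) (fn := fn)) => // n; exists n.
have cvg2 : I (fn n.+1) @[n --> \oo] -->
    (2^-1%:E * (I (f \o coin_cons true) + I (f \o coin_cons false)))%E.
  under eq_cvg do rewrite stepn.
  apply: cvgeZl => //; apply: cvgeD; [|exact: cvgI|exact: cvgI].
  by apply: fin_num_adde_defr; apply: fin.
exact: (cvg_unique _ cvg1 cvg2).
Qed.

End FairCoins.

(** * Histories and the first stage of a play *)

Section Histories.
Context {R : realType} {N : nat}.
Local Notation position := (position R N).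
Local Notation stage := (stage R N).
Local Notation history k := (history R N k).
Local Notation play := (@play R N).
Local Notation policy := (@policy R N).
Implicit Types (s : stage) (x p : position) (w : play) (c : nat -> bool).

Definition history_cons {k} s (h : history k) : history k.+1 :=
  (cons_tuple s h.1, h.2).

Definition history_tail {k} (h : history k.+1) : history k :=
  (behead_tuple h.1, h.2).

Definition history_start {k} : history k -> position :=
  if k is k'.+1 then fun h => (thead h.1).1 else fun h => h.2.

Definition play_cons s w : play := fun k => if k is k'.+1 then w k' else s.

Definition play_tail w : play := fun k => w k.+1.

Lemma history_consK {k} s (h : history k) : history_tail (history_cons s h) = h.
Proof. by case: h => h p; congr (_, _); exact: val_inj. Qed.

Lemma history_start_of k w : history_start (history_of k w) = (w 0%N).1.
Proof. by case: k => [//|k]; rewrite /= /thead tnth_mktuple. Qed.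

Lemma history_of_cons k s w :
  history_of k.+1 (play_cons s w) = history_cons s (history_of k w).
Proof.
congr (_, _); apply: eq_from_tnth => i; rewrite tnth_mktuple.
case: (unliftP ord0 i) => [j ->|->]; last by rewrite tnth0.
by rewrite tnthS tnth_mktuple.
Qed.

Lemma history_of_tail k w :
  history_of k (play_tail w) = history_tail (history_of k.+1 w).
Proof.
congr (_, _); apply: eq_from_tnth => i.
by rewrite tnth_behead !tnth_mktuple /play_tail inordK// ltnS.
Qed.

Lemma measurable_history_cons k s : measurable_fun setT (@history_cons k s).
Proof.
apply: measurable_fun_pair; last exact: measurable_snd.
exact: (measurable_cons (f := cst s) (measurable_cst s) measurable_fst).
Qed.

Lemma measurable_history_tail k : measurable_fun setT (@history_tail k).
Proof.
apply: measurable_fun_pair; last exact: measurable_snd.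
apply: (measurableT_comp (f := @behead_tuple k.+1 stage)) measurable_fst.
exact: measurable_behead.
Qed.

Lemma measurable_history_start k : measurable_fun setT (@history_start k).
Proof.
case: k => [|k]; first exact: measurable_snd.
apply: (measurableT_comp measurable_fst).
rewrite (_ : (fun h : history k.+1 => thead h.1) = (@tnth _ _ ^~ ord0) \o fst) //.
apply: measurableT_comp; last exact: measurable_fst.
exact: measurable_tnth.
Qed.

(** This is where a strategy may treat finitely many positions separately:
    points are closed, hence Borel. *)
Lemma measurable_eq_point d (X : measurableType d) (f : X -> position) p :
  measurable_fun setT f -> measurable_fun setT (fun z => `[< f z = p >]).
Proof.
move=> mf; apply: (measurable_fun_bool true).
rewrite (_ : _ @^-1` _ = f @^-1` [set p]); last first.
  by apply/seteqP; split=> z /=; [move=> /asboolP|move=> ?; apply/asboolP].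
apply: mf => //; rewrite -[X in measurable X]setCK; apply: measurableC.
apply: sub_sigma_algebra; apply: closed_openC.
exact: (accessible_closed_set1 (hausdorff_accessible (@norm_hausdorff _ _))).
Qed.

Lemma run_nonanticipating (SI SII : policy) x k c c' :
  (forall i, (i < k)%N -> c i = c' i) ->
  run SI SII x c k = run SI SII x c' k.
Proof.
elim: k => [//|k IH] cc' /=; rewrite IH ?cc' // => i ik.
by apply: cc'; rewrite ltnW.
Qed.

Lemma history_of_run_nonanticipating (SI SII : policy) x k c c' :
  (forall i, (i < k)%N -> c i = c' i) ->
  history_of k (run_play SI SII x c) = history_of k (run_play SI SII x c').
Proof.
move=> cc'; have H i : (i <= k)%N ->
    run_play SI SII x c i = run_play SI SII x c' i.
  move=> ik; rewrite /run_play (@run_nonanticipating SI SII x i c c')// => j ji.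
  apply: cc'; exact: leq_trans ji ik.
rewrite /history_of H//; congr (_, _).
by apply: eq_from_tnth => i; rewrite !tnth_mktuple H// ltnW.
Qed.

(** After a first stage in which the token moved from [x] to [p], the policies
    [SI] and [SII] go on as [KI] and [KII]; this is only required on histories
    that start at [p], the only ones that can occur. *)
Section FirstStage.
Variables (SI SII KI KII : policy) (x p : position) (b : bool).
Let s : stage := (x, (SI ([tuple], x), SII ([tuple], x))).
Hypothesis pE : p = if b then s.2.1 else s.2.2.
Hypothesis KIE : forall k (h : history k), history_start h = p ->
  SI (history_cons s h) = KI h.
Hypothesis KIIE : forall k (h : history k), history_start h = p ->
  SII (history_cons s h) = KII h.

Lemma history_start_run S S' c k : history_start (run S S' p c k) = p.
Proof.
elim: k => [//|k IH]; rewrite /= /thead (tnth_nth s) /= nth_rcons size_tuple.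
by case: k IH => [//|k] /=; rewrite /thead (tnth_nth s).
Qed.

Lemma run_first_stage c k :
  run SI SII x (coin_cons b c) k.+1 = history_cons s (run KI KII p c k).
Proof.
elim: k => [|k IH].
  by rewrite /= pE; congr (_, _); exact: val_inj.
have st := history_start_run KI KII c k.
transitivity (let h := history_cons s (run KI KII p c k) in
    let a := (SI h, SII h) in
    (rcons_tuple h.1 (h.2, a), if c k then a.1 else a.2) : history k.+2).
  by rewrite -IH.
by rewrite /= KIE// KIIE//; congr (_, _); exact: val_inj.
Qed.

Lemma run_play_first_stage c :
  run_play SI SII x (coin_cons b c) = play_cons s (run_play KI KII p c).
Proof.
apply/funext => -[//|k]; rewrite {1}/run_play run_first_stage /=.
have st := history_start_run KI KII c k.
by rewrite KIE// KIIE.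
Qed.

End FirstStage.

End Histories.

(** * The end of the game *)

Section EndOfGame.
Context {R : realType} {N : nat} (Om : set 'rV[R]_N) (gamma : R).
Local Notation play := (@play R N).
Local Notation ends_at := (ends_at Om gamma).
Local Notation terminates := (terminates Om gamma).
Local Notation end_time := (end_time Om gamma).
Local Notation terminal_position := (terminal_position Om gamma).
Implicit Types (tau : play -> nat) (w : play) (q : 'rV[R]_N -> R).

(** One functional for two purposes: with [q = cst 1] and [v = 0] it is the
    indicator of termination, and with the payoff for [q] it is the payoff, with
    [v] on the plays that never end.  There the payoff itself falls back on the
    initial position, which changes when the first stage of a play is deleted; a
    fixed [v] does not. *)
Definition stopped_value tau q (v : R) w : R :=
  if `[< terminates tau w >] then q (terminal_position tau w) else v.

Lemma end_timeE tau w k : ends_at tau w k ->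
  (forall j, (j < k)%N -> ~ ends_at tau w j) -> end_time tau w = k.
Proof.
move=> ek nj; apply: xget_unique => // j [ej nk].
by case: (ltngtP j k) => // [/nj|/nk].
Qed.

Lemma ends_at_first tau w n : ends_at tau w n ->
  exists k, [/\ (k <= n)%N, ends_at tau w k &
                forall j, (j < k)%N -> ~ ends_at tau w j].
Proof.
elim/ltn_ind: n => n IH en.
have [[j jn ej]|nex] := pselect (exists2 j, (j < n)%N & ends_at tau w j).
  have [k [kj ek nk]] := IH j jn ej.
  by exists k; split=> //; exact: leq_trans kj (ltnW jn).
by exists n; split=> // j jn ej; apply: nex; exists j.
Qed.

Lemma stopped_value_default tau q w :
  stopped_value tau q (q (w 0%N).1) w = q (terminal_position tau w).
Proof.
rewrite /stopped_value; case: asboolP => // nt.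
rewrite /Defs.terminal_position /Defs.end_time xgetPN// => k [ek _].
by apply: nt; exists k.
Qed.

(** Deleting the first stage lowers the end time by one, and leaves the terminal
    position as it is. *)
Lemma stopped_value_cons tau tau' q v s w :
  ~ outer_strip Om gamma s.1 -> tau (play_cons s w) = (tau' w).+1 ->
  stopped_value tau q v (play_cons s w) = stopped_value tau' q v w.
Proof.
move=> ns tauE.
have e0 : ~ ends_at tau (play_cons s w) 0 by case=> //; rewrite tauE.
have eS k : ends_at tau (play_cons s w) k.+1 <-> ends_at tau' w k.
  rewrite /Defs.ends_at tauE /=.
  by split=> -[?|]; [left|move=> [->]; right|left|move=> ->; right].
rewrite /stopped_value; case: asboolP => t; case: asboolP => t' //.
- case: t' => n /ends_at_first[k [_ ek nk]].
  rewrite /Defs.terminal_position (@end_timeE tau' w k)//.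
  rewrite (@end_timeE tau _ k.+1)//; first by apply/eS.
  by case=> [|j] //; rewrite ltnS => /nk nj /eS.
- by case: t => -[/e0//|k] /eS ek; case: t'; exists k.
- by case: t' => k /eS ek; case: t; exists k.+1.
Qed.

Lemma ends_at_nonanticipating tau w w' k : stopping_rule tau ->
  history_of k w = history_of k w' -> ends_at tau w k -> ends_at tau w' k.
Proof.
move=> st ww'; have [A _ tauA] := st k; case => [ow|tk].
  by left; move: ww' => -[_ <-].
right; suff : [set w | tau w = k] w' by [].
by rewrite tauA /preimage /= -ww' -[A _]/((_ @^-1` A) w) -tauA.
Qed.

Section Approximation.
Variables (SI SII : @policy R N) (x : position R N) (tau : play -> nat).
Hypothesis tau_rule : stopping_rule tau.
Let w c : play := run_play SI SII x c.

(** The n-th approximation is [v] on the plays that last n stages or more.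
    Whether the game ends at stage k, and where, is determined by the first k
    tosses, since a stopping rule only sees the history. *)
Lemma finitely_approximable_stopped_value (M : R) q v :
  (forall c k, (forall j, (j < k)%N -> ~ ends_at tau (w c) j) ->
    `|q (w c k).1| <= M) ->
  finitely_approximable (fun c => stopped_value tau q v (w c)).
Proof.
move=> qM; pose early n c := exists2 k, (k < n)%N & ends_at tau (w c) k.
exists (Num.max M `|v|), (fun n c => if `[< early n c >]
  then q (terminal_position tau (w c)) else v).
have ends_dep n c c' k : (forall i, (i < n)%N -> c i = c' i) -> (k <= n)%N ->
    ends_at tau (w c) k -> ends_at tau (w c') k.
  move=> cc' kn; apply: ends_at_nonanticipating => //.
  apply: history_of_run_nonanticipating.
  by move=> i ik; apply: cc'; exact: leq_trans kn.
split=> [n c c' cc'|n c|c].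
- have c'c i : (i < n)%N -> c' i = c i by move=> /cc'.
  case: asboolP => [[k kn]|ne]; last first.
    case: asboolP => // -[k kn /(ends_dep n _ _ _ c'c (ltnW kn)) ek].
    by case: ne; exists k.
  move=> /ends_at_first [j [jk ej nj]]; have jn := leq_ltn_trans jk kn.
  have ej' := ends_dep n _ _ _ cc' (ltnW jn) ej.
  rewrite asboolT; last by exists j.
  rewrite /Defs.terminal_position (@end_timeE tau (w c) j)//.
  rewrite (@end_timeE tau (w c') j)//.
    rewrite /w /run_play /= (@run_nonanticipating _ _ _ _ _ j c c')// => i ij.
    by apply: cc'; exact: ltn_trans jn.
  move=> i ij /(ends_dep n _ _ _ c'c) ei; apply: (nj i ij); apply: ei.
  exact: ltnW (ltn_trans ij jn).
- rewrite le_max; case: asboolP => [[k _ /ends_at_first[j [_ ej nj]]]|_].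
    by rewrite /Defs.terminal_position (@end_timeE tau (w c) j)// qM.
  by rewrite lexx orbT.
- apply: cvg_near_cst; rewrite /stopped_value; case: (asboolP (terminates _ _)).
    move=> [k ek]; exists k.+1 => // n /= kn; rewrite asboolT//.
    by exists k.
  move=> nt; apply: nearW => n; rewrite asboolF// => -[k _ ek].
  by apply: nt; exists k.
Qed.

End Approximation.
End EndOfGame.

(** * The expected payoff *)

Section ExpectedPayoff.
Context {R : realType} {N : nat} (Om : set 'rV[R]_N) (gamma eps : R).
Context (F Psi : 'rV[R]_N -> R).
Context {d} {T : measurableType d} (P : probability T R).
Context (coin : nat -> T -> bool) (fair : fair_coins P coin).
(* [D] is a region that the token cannot leave before the game ends, and on
   which the payoff is bounded. *)
Context (D : set 'rV[R]_N) (M : R).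
Hypothesis ballD : forall p, Om p -> eball p eps `<=` D.
Hypothesis D_Om : forall p, D p -> ~ outer_strip Om gamma p -> Om p.
Hypothesis payoff_le : forall p, D p -> `|payoff Om F Psi p| <= M.

Local Notation play := (@play R N).
Local Notation policy := (@policy R N).
Local Notation expected_payoff := (expected_payoff Om gamma F Psi P coin).
Local Notation stopped_value := (stopped_value Om gamma).
Local Notation pay := (payoff Om F Psi).
Local Notation strategy := (@strategy R N eps).

Lemma play_stays tau SI SII x c k : strategy SI -> strategy SII -> D x ->
  (forall j, (j < k)%N -> ~ ends_at Om gamma tau (run_play SI SII x c) j) ->
  D (run_play SI SII x c k).1.
Proof.
move=> sI sII Dx; elim: k => [//|k IH] nj.
have Dk : D (run_play SI SII x c k).1 by apply: IH => j jk; apply: nj; exact: ltnW.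
have Ok : Om (run_play SI SII x c k).1.
  by apply: D_Om => // ok; apply: (nj k) => //; left.
apply: (ballD Ok); rewrite /run_play /=; case: ifP => _.
  by have [_] := sI k; apply.
by have [_] := sII k; apply.
Qed.

Section Play.
Variables (tau : play -> nat) (SI SII : policy) (x : 'rV[R]_N).
Hypotheses (tau_rule : stopping_rule tau).
Hypotheses (sI : strategy SI) (sII : strategy SII) (Dx : D x).

Definition termination_probability : \bar R :=
  \int[P]_t (stopped_value tau (cst 1) 0 (random_play coin SI SII x t))%:E.

Definition payoff_on_termination : \bar R :=
  \int[P]_t (stopped_value tau pay 0 (random_play coin SI SII x t))%:E.

Lemma approximable_indicator :
  finitely_approximable (fun c => stopped_value tau (cst 1) 0 (run_play SI SII x c)).
Proof.
by apply: (finitely_approximable_stopped_value tau_rule (M := 1)) => c k _;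
  rewrite normr1.
Qed.

Lemma approximable_payoff v :
  finitely_approximable (fun c => stopped_value tau pay v (run_play SI SII x c)).
Proof.
apply: (finitely_approximable_stopped_value tau_rule (M := M)) => c k nj.
by apply: payoff_le; exact: play_stays nj.
Qed.

Let terminating : set T :=
  [set t | terminates Om gamma tau (random_play coin SI SII x t)].

Let stopped_value_indic t :
  stopped_value tau (cst 1) 0 (random_play coin SI SII x t) = \1_terminating t.
Proof.
rewrite /stopped_value indicE; case: asboolP => ht; first by rewrite mem_set.
by rewrite memNset.
Qed.

Let measurable_terminating : measurable terminating.
Proof.
apply/(measurable_indicP R).
have := measurable_finitely_approximable fair approximable_indicator.
by congr measurable_fun; apply/funext => t; rewrite -stopped_value_indic.
Qed.

Lemma termination_probabilityE : termination_probability = P terminating.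
Proof.
rewrite /termination_probability; under eq_integral do rewrite stopped_value_indic.
by rewrite integral_indic// setIT.
Qed.

Lemma terminates_ae :
  {ae P, forall t, terminates Om gamma tau (random_play coin SI SII x t)} <->
  termination_probability = 1%E.
Proof.
rewrite termination_probabilityE; split=> [[A [mA PA0 nA]]|P1].
  apply/eqP; rewrite eq_le probability_le1//=.
  have <- : P (~` A) = 1%E by rewrite probability_setC// PA0 sube0.
  rewrite le_measure ?inE//; first exact: measurableC.
  by move=> t /= nAt; apply: contrapT => nt; apply: nAt; apply: nA.
exists (~` terminating); split=> //; first exact: measurableC.
by rewrite probability_setC// P1 subee.
Qed.

(** The payoff may be replaced by 0 on the null set of plays that never end. *)
Lemma expected_payoffE v : expected_payoff v x tau SI SII =
  if termination_probability == 1%E then payoff_on_termination else v.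
Proof.
rewrite /expected_payoff; case: asboolP; rewrite terminates_ae; last first.
  by move=> /eqP/negbTE ->.
move=> t1; rewrite t1 eqxx; move/terminates_ae : t1 => tae.
rewrite unlock; apply: ae_eq_integral => //.
- apply/measurable_EFinP.
  have := measurable_finitely_approximable fair (approximable_payoff (pay x)).
  by congr measurable_fun; apply/funext => t; rewrite -stopped_value_default.
- apply/measurable_EFinP.
  exact: (measurable_finitely_approximable fair (approximable_payoff 0)).
apply: filterS tae => t ht _ /=.
by rewrite /stopped_value asboolT.
Qed.

Lemma termination_probability_le1 : (termination_probability <= 1)%E.
Proof. by rewrite termination_probabilityE probability_le1. Qed.

Lemma termination_probability_fin : termination_probability \is a fin_num.
Proof. by rewrite termination_probabilityE fin_num_measure. Qed.

Lemma payoff_on_termination_fin : payoff_on_termination \is a fin_num.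
Proof.
apply: integrable_fin_num => //.
exact: (integrable_finitely_approximable fair (approximable_payoff 0)).
Qed.

End Play.

(** The continuations after the first stage are given as families indexed by the
    position reached, [y] or [z]: when [y = z] the two outcomes of the toss lead
    to the same histories, so that the continuation must be the same. *)
Section FirstStage.
Variables (tau : play -> nat) (SI SII : policy) (x : 'rV[R]_N).
Let y : 'rV[R]_N := SI ([tuple], x : position R N).
Let z : 'rV[R]_N := SII ([tuple], x : position R N).
Let s : stage R N := (x, (y, z)).
Variables (Ktau : 'rV[R]_N -> play -> nat) (KI KII : 'rV[R]_N -> policy).
Hypotheses (tau_rule : stopping_rule tau) (sI : strategy SI) (sII : strategy SII).
Hypothesis K_valid : forall p, [set y; z] p ->
  [/\ stopping_rule (Ktau p), strategy (KI p) & strategy (KII p)].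
Hypothesis KI_E : forall k (h : history R N k), [set y; z] (history_start h) ->
  SI (history_cons s h) = KI (history_start h) h.
Hypothesis KII_E : forall k (h : history R N k), [set y; z] (history_start h) ->
  SII (history_cons s h) = KII (history_start h) h.
Hypothesis Ktau_E : forall w : play, [set y; z] (w 0%N).1 ->
  tau (play_cons s w) = (Ktau (w 0%N).1 w).+1.
Hypotheses (Omx : Om x) (Dx : D x).

(** The case [v = -oo] is the payoff of Player I, the case [v = +oo] that of
    Player II: an infinite [v] absorbs the other term of the mean, as it should,
    since one continuation that may last forever makes the whole game so. *)
Lemma expected_payoff_first_stage v : v = -oo%E \/ v = +oo%E ->
  expected_payoff v x tau SI SII =
  (2^-1%:E * (expected_payoff v y (Ktau y) (KI y) (KII y) +
              expected_payoff v z (Ktau z) (KI z) (KII z)))%E.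
Proof.
move=> v_infty.
have [ty sIy sIIy] : [/\ stopping_rule (Ktau y), strategy (KI y) & strategy (KII y)].
  by apply: K_valid; left.
have [tz sIz sIIz] : [/\ stopping_rule (Ktau z), strategy (KI z) & strategy (KII z)].
  by apply: K_valid; right.
have Dy : D y by apply: (ballD Omx); have [_] := sI 0%N; apply.
have Dz : D z by apply: (ballD Omx); have [_] := sII 0%N; apply.
have nx : ~ outer_strip Om gamma x by case.
have tossE q b c :
    stopped_value tau q 0 (run_play SI SII x (coin_cons b c)) =
    let p := if b then y else z in
    stopped_value (Ktau p) q 0 (run_play (KI p) (KII p) p c).
  set p := if b then y else z.
  have yzp : [set y; z] p by rewrite /p; case: (b); [left|right].
  rewrite (@run_play_first_stage _ _ SI SII (KI p) (KII p) x p b) //.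
  - by apply: stopped_value_cons => //; rewrite Ktau_E.
  - by move=> k h hp; rewrite KI_E hp.
  - by move=> k h hp; rewrite KII_E hp.
have stepE q :
    finitely_approximable
      (fun c => stopped_value tau q 0 (run_play SI SII x c)) ->
    (\int[P]_t (stopped_value tau q 0 (random_play coin SI SII x t))%:E =
     2^-1%:E * (
      \int[P]_t (stopped_value (Ktau y) q 0
        (random_play coin (KI y) (KII y) y t))%:E +
      \int[P]_t (stopped_value (Ktau z) q 0
        (random_play coin (KI z) (KII z) z t))%:E))%E.
  move=> aq; rewrite /random_play (integral_coin_cons fair aq).
  under eq_integral do rewrite (tossE q true).
  by under [X in (_ * (_ + X))%E]eq_integral do rewrite (tossE q false).
rewrite (expected_payoffE tau_rule sI sII Dx).
rewrite (expected_payoffE ty sIy sIIy Dy) (expected_payoffE tz sIz sIIz Dz).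
rewrite [termination_probability _ _ _ _]stepE; last exact: approximable_indicator.
rewrite [payoff_on_termination tau _ _ _]stepE; last exact: approximable_payoff.
rewrite -/(termination_probability (Ktau y) (KI y) (KII y) y).
rewrite -/(termination_probability (Ktau z) (KI z) (KII z) z).
rewrite -/(payoff_on_termination (Ktau y) (KI y) (KII y) y).
rewrite -/(payoff_on_termination (Ktau z) (KI z) (KII z) z).
(* A mean of two numbers that are at most 1 equals 1 only if both do. *)
have := termination_probability_le1 (KI y) (KII y) y ty.
have := termination_probability_le1 (KI z) (KII z) z tz.
have := termination_probability_fin (KI y) (KII y) y ty.
have := termination_probability_fin (KI z) (KII z) z tz.
have := payoff_on_termination_fin ty sIy sIIy Dy.
have := payoff_on_termination_fin tz sIz sIIz Dz.
case: payoff_on_termination => // a _; case: payoff_on_termination => // b _.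
case: termination_probability => // r _; case: termination_probability => // r' _.
rewrite !lee_fin -EFinD -EFinM !eqe => r1 r'1.
have [->|ry] := eqVneq r' 1; have [->|rz] := eqVneq r 1.
- by rewrite ifT//; apply/eqP; lra.
- rewrite ifF; last by apply/negbTE; move: rz; apply: contra_neq; lra.
  by case: v_infty => ->;
    rewrite /= ?addeNy ?addey// ?gt0_muleNy ?gt0_muley// lte_fin invr_gt0.
- rewrite ifF; last by apply/negbTE; move: ry; apply: contra_neq; lra.
  by case: v_infty => ->;
    rewrite /= ?addNye ?addye// ?gt0_muleNy ?gt0_muley// lte_fin invr_gt0.
- rewrite ifF; last by apply/negbTE; move: ry; apply: contra_neq; lra.
  by case: v_infty => ->;
    rewrite /= ?addNye ?addye// ?gt0_muleNy ?gt0_muley// lte_fin invr_gt0.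
Qed.

End FirstStage.
End ExpectedPayoff.

(** * The region visited by the token *)

Section Geometry.
Context {R : realType} {N : nat}.
Implicit Types (v p q : 'rV[R]_N) (A Om : set 'rV[R]_N).

Lemma enorm0 : enorm (0 : 'rV[R]_N) = 0.
Proof. by rewrite /enorm big1 ?sqrtr0// => i _; rewrite mxE expr0n. Qed.

Lemma enorm_ge0 v : 0 <= enorm v.
Proof. exact: sqrtr_ge0. Qed.

Lemma enormZ (a : R) v : enorm (a *: v) = `|a| * enorm v.
Proof.
rewrite /enorm; under eq_bigr do rewrite mxE exprMn.
by rewrite -mulr_sumr sqrtrM ?sqr_ge0// sqrtr_sqr.
Qed.

Lemma coord_le_enorm v i : `|v 0 i| <= enorm v.
Proof.
rewrite -sqrtr_sqr ler_wsqrtr// (bigD1 i)//= lerDl sumr_ge0// => j _.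
exact: sqr_ge0.
Qed.

Lemma enorm_le_coord (b : R) v : (forall i, `|v 0 i| <= b) ->
  enorm v <= Num.sqrt (\sum_(i < N) b ^+ 2).
Proof.
move=> vb; rewrite ler_wsqrtr//; apply: ler_sum => i _.
by rewrite -real_normK ?num_real// lerXn2r ?nnegrE ?(le_trans _ (vb i)).
Qed.

Lemma eball_center p (e : R) : 0 < e -> eball p e p.
Proof. by rewrite /eball /= subrr enorm0. Qed.

Lemma lipschitz_in_bounded A E f (B : R) : lipschitz_in A f -> E `<=` A ->
  (forall p, E p -> forall i, `|p 0 i| <= B) ->
  exists M : R, forall p, E p -> `|f p| <= M.
Proof.
move=> [L fL] EA EB; have [[a Ea]|nE] := pselect (E !=set0); last first.
  by exists 0 => p Ep; case: nE; exists p.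
pose C := Num.sqrt (\sum_(i < N) (B + B) ^+ 2) : R.
exists (`|f a| + `|L| * C) => p Ep; rewrite -[f p](subrK (f a)) addrC.
rewrite (le_trans (ler_normD _ _)) // lerD2l (le_trans (fL _ _ (EA _ Ep) (EA _ Ea)))//.
rewrite (le_trans (ler_norm _))// normrM (ger0_norm (enorm_ge0 _)).
apply: ler_wpM2l => //; apply: enorm_le_coord => i.
by rewrite !mxE (le_trans (ler_normB _ _))// lerD// EB.
Qed.

Lemma bounded_set_coord A : bounded_set A ->
  exists B : R, forall p, A p -> forall i, `|p 0 i| <= B.
Proof.
move=> [b [_ Ab]]; exists (b + 1) => p Ap i.
have := Ab (b + 1) _ p Ap; rewrite ltrDl ltr01 => /(_ isT).
apply: le_trans; rewrite /Num.norm /= mx_normrE.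
by apply: le_trans (le_bigmax _ _ (0, i)).
Qed.

(** Otherwise the part of the segment in [Om] would be both open and closed in
    the segment. *)
Lemma segment_meets_boundary Om q p : open Om -> Om q -> ~ Om p ->
  exists2 t : R, 0 <= t <= 1 & boundary Om (q + t *: (p - q)).
Proof.
move=> oOm Omq nOmp; apply: contrapT => nb.
pose g (t : R) := q + t *: (p - q).
pose C := g @` `[0, 1].
have Cc : connected C.
  apply: connected_continuous_connected; first exact: segment_connected.
  apply: continuous_subspaceT => t; apply: cvgD; first exact: cvg_cst.
  by apply: cvgZr_tmp.
have Cp : C p by exists 1; rewrite /= ?in_itv /= ?lexx ?ler01// /g scale1r addrC subrK.
have Cq : C q by exists 0; rewrite /= ?in_itv /= ?lexx ?ler01// /g scale0r addr0.
suff /seteqP[_ /(_ p Cp)[]] : C `&` Om = C by [].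
apply: Cc; first by exists q.
  by exists Om.
exists (closure Om); first exact: closed_closure.
apply/seteqP; split=> [r [Cr Or]|r [Cr cr]]; split=> //.
  exact: subset_closure.
apply: contrapT => nOr; apply: nb; case: Cr => t /=; rewrite in_itv /= => t01 gt.
exists t => //; rewrite -/(g t) gt; split=> //.
by move=> /interior_subset.
Qed.

(** Every position visited up to the end of a game started in [Om] lies here, so
    the payoff need only be bounded on this set, whatever the size of the outer
    strip. *)
Definition fattening Om (eps : R) : set 'rV[R]_N :=
  [set p | exists2 q, Om q & eball q eps p].

(** The segment from a point of [Om] within [eps] of [p] to [p] crosses the
    boundary, at a point even closer to [p]. *)
Lemma fattening_outer_strip Om (gamma eps : R) p : open Om -> eps <= gamma ->
  fattening Om eps p -> ~ Om p -> outer_strip Om gamma p.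
Proof.
move=> oOm eg [q Omq qp] nOmp; split=> //.
have [t /andP[t0 t1] bt] := segment_meets_boundary oOm Omq nOmp.
rewrite (le_trans _ eg)// (le_trans _ (ltW qp))//.
apply: (@le_trans _ _ (enorm (p - (q + t *: (p - q))))).
  apply: ge_inf; last by exists (q + t *: (p - q)).
  by exists 0 => _ [r _ <-]; exact: enorm_ge0.
rewrite (_ : p - _ = (1 - t) *: (p - q)); last first.
  by rewrite scalerBl scale1r opprD addrA.
by rewrite enormZ ger0_norm ?subr_ge0// ler_piMl ?enorm_ge0// gerBl.
Qed.

Lemma fattening_coord Om (eps : R) : bounded_set Om ->
  exists B : R, forall p, fattening Om eps p -> forall i, `|p 0 i| <= B.
Proof.
move=> /bounded_set_coord[B OB]; exists (eps + B) => p [q Oq qp] i.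
rewrite -[p](subrK q) mxE (le_trans (ler_normD _ _))// lerD// ?OB//.
exact: le_trans (coord_le_enorm _ _) (ltW qp).
Qed.

Lemma payoff_bounded Om (gamma eps : R) F Psi :
  open Om -> bounded_set Om -> eps <= gamma ->
  lipschitz_in (outer_strip Om gamma) F -> lipschitz_in setT Psi ->
  exists M : R, forall p, fattening Om eps p -> `|payoff Om F Psi p| <= M.
Proof.
move=> oOm bOm eg hF hPsi; have [B DB] := fattening_coord eps bOm.
have [MP PM] := lipschitz_in_bounded hPsi (@subsetT _ _) DB.
have [MF FM] := lipschitz_in_bounded hF
  (@subIsetr _ (fattening Om eps) _) (fun p Ep => DB p (proj1 Ep)).
exists (Num.max MF MP) => p Dp; rewrite /payoff le_max; case: ifPn.
  by rewrite PM ?orbT.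
rewrite notin_setE => nOmp; rewrite FM//; split=> //.
exact: fattening_outer_strip Dp nOmp.
Qed.

End Geometry.

(** * Continuations and glued strategies *)

Section Glue.
Context {R : realType} {N : nat} (eps : R).
Local Notation position := (position R N).
Local Notation stage := (stage R N).
Local Notation history k := (history R N k).
Local Notation play := (@play R N).
Local Notation policy := (@policy R N).
Local Notation strategy := (@strategy R N eps).
Implicit Types (s : stage) (x p y z : position) (w : play).

Lemma strategy_stay : 0 < eps -> strategy (fun k (h : history k) => h.2).
Proof.
by move=> e0 k; split; [exact: measurable_snd|move=> h; exact: eball_center].
Qed.

Lemma stopping_rule_at_once : stopping_rule (fun _ : play => 0%N).
Proof.
move=> [|k]; first by exists setT => //; apply/seteqP; split.
by exists set0 => //; apply/seteqP; split.
Qed.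

Definition policy_after s (S : policy) : policy :=
  fun k h => S k.+1 (history_cons s h).

Lemma strategy_after s S : strategy S -> strategy (policy_after s S).
Proof.
move=> sS k; have [mS bS] := sS k.+1; split; last by move=> h; exact: bS.
by apply: measurableT_comp mS _; exact: measurable_history_cons.
Qed.

Definition rule_after s (tau : play -> nat) : play -> nat :=
  fun w => (tau (play_cons s w)).-1.

Lemma stopping_rule_after s tau : (forall w, tau (play_cons s w) != 0%N) ->
  stopping_rule tau -> stopping_rule (rule_after s tau).
Proof.
move=> t0 ts k; have [A mA tA] := ts k.+1.
exists (history_cons s @^-1` A).
  rewrite -[X in measurable X]setTI.
  exact: (@measurable_history_cons _ _ k s).
apply/seteqP; rewrite /preimage; split=> w /=; rewrite -history_of_cons => tw.
  have : [set w | tau w = k.+1] (play_cons s w).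
    by move: tw (t0 w); rewrite /rule_after /=; case: (tau _) => //= n ->.
  by rewrite tA.
have : [set w | tau w = k.+1] (play_cons s w) by rewrite tA.
by rewrite /rule_after /= => ->.
Qed.

(** Move to [a] from [x], then follow [K y] or [K z] according to the position
    after the first stage.  Histories that do not begin at [x] never occur, but a
    strategy must still prescribe an admissible action there: the token stays. *)
Definition glue_policy x (a : position) y z (K : position -> policy) : policy :=
  fun k => if k is k'.+1 then fun h =>
      if `[< history_start (history_tail h) = y >]
      then K y k' (history_tail h) else K z k' (history_tail h)
    else fun h => if `[< h.2 = x >] then a else h.2.

Lemma glue_policy_cons x a y z K s k (h : history k) :
  [set y; z] (history_start h) ->
  glue_policy x a y z K (history_cons s h) = K (history_start h) k h.
Proof.
rewrite /glue_policy history_consK; case: asboolP => [-> //|].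
by move=> ny [|->].
Qed.

Lemma glue_policy_first x a y z K : glue_policy x a y z K ([tuple], x) = a.
Proof. by rewrite /glue_policy /= asboolT. Qed.

Lemma strategy_glue x a y z K : 0 < eps -> eball x eps a ->
  strategy (K y) -> strategy (K z) -> strategy (glue_policy x a y z K).
Proof.
move=> e0 xa sy sz [|k]; split.
- apply: measurable_fun_ifT; [|exact: measurable_cst|exact: measurable_snd].
  exact: measurable_eq_point measurable_snd.
- by move=> h; rewrite /glue_policy; case: asboolP => [->|_] //; exact: eball_center.
- have [[my _] [mz _]] := (sy k, sz k); have mt := @measurable_history_tail R N k.
  apply: measurable_fun_ifT.
  + apply: measurable_eq_point; apply: measurableT_comp mt.
    exact: measurable_history_start.
  + exact: measurableT_comp my mt.
  + exact: measurableT_comp mz mt.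
- move=> h; have [[_ bY] [_ bZ]] := (sy k, sz k); rewrite /glue_policy.
  by case: asboolP => _; [exact: (bY (history_tail h))|exact: (bZ (history_tail h))].
Qed.

Definition glue_rule y z (K : position -> play -> nat) : play -> nat :=
  fun w => (if `[< (w 1%N).1 = y >] then K y (play_tail w)
            else K z (play_tail w)).+1.

Lemma glue_rule_cons y z K s w : [set y; z] (w 0%N).1 ->
  glue_rule y z K (play_cons s w) = (K (w 0%N).1 w).+1.
Proof.
by rewrite /glue_rule /=; case: asboolP => [-> //|ny [|->]].
Qed.

Lemma stopping_rule_glue y z K : stopping_rule (K y) -> stopping_rule (K z) ->
  stopping_rule (glue_rule y z K).
Proof.
move=> ky kz [|k]; first by exists set0 => //; apply/seteqP; split.
have [[A mA kA] [B mB kB]] := (ky k, kz k).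
have mt := @measurable_history_tail R N k.
pose E : set (history k.+1) := [set h | history_start (history_tail h) = y].
have mE : measurable E.
  have := @measurable_eq_point _ _ _ _ _ y
    (measurableT_comp (@measurable_history_start R N k) mt).
  move=> /(_ measurableT [set true]); rewrite setTI.
  rewrite (_ : _ @^-1` _ = E); first exact.
  by apply/seteqP; split=> h /=; [move=> /asboolP|move=> ?; apply/asboolP].
exists ((E `&` history_tail @^-1` A) `|` (~` E `&` history_tail @^-1` B)).
  apply: measurableU; apply: measurableI => //; last 1 first.
  - by rewrite -[X in measurable X]setTI; exact: mt.
  - by rewrite -[X in measurable X]setTI; exact: mt.
  - exact: measurableC.
have iffA w : A (history_of k w) <-> K y w = k.
  by have := congr1 (@^~ w) kA => /= /propeqP ->.
have iffB w : B (history_of k w) <-> K z w = k.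
  by have := congr1 (@^~ w) kB => /= /propeqP ->.
have startE w : E (history_of k.+1 w) <-> (w 1%N).1 = y.
  by rewrite /E /= -history_of_tail history_start_of.
apply/seteqP; split=> w; rewrite /preimage /setU /setI /setC /= -history_of_tail.
  rewrite /glue_rule; case: asboolP => [w1 [kw]|w1 [kw]].
    by left; split; [apply/startE|apply/iffA].
  by right; split; [move=> /startE|apply/iffB].
rewrite /glue_rule => -[[/startE w1 /iffA <-]|[nw /iffB <-]].
  by rewrite asboolT.
by rewrite asboolF// => /startE.
Qed.

(** The decision to stop at stage 0 depends on the initial position alone. *)
Lemma stopping_rule_zero x tau : stopping_rule tau ->
  (forall w, (w 0%N).1 = x -> tau w = 0%N) \/
  (forall w, (w 0%N).1 = x -> tau w != 0%N).
Proof.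
move=> /(_ 0%N)[A _ tA].
have iffA w : (w 0%N).1 = x -> tau w = 0%N <-> A ([tuple], x).
  move=> wx; have := congr1 (@^~ w) tA => /= /propeqP ->.
  rewrite /preimage /= (_ : history_of 0 w = ([tuple], x))//.
  by congr (_, _); rewrite ?[LHS]tuple0 ?[RHS]tuple0.
have [Ax|nAx] := pselect (A ([tuple], x)); [left|right] => w wx.
  exact/iffA.
by apply/eqP => tw0; apply: nAx; apply/(iffA w wx).
Qed.

End Glue.

(** * The dynamic programming inequalities *)

Section Value.
Context {R : realType} {N : nat} (Om : set 'rV[R]_N) (gamma eps : R).
Context (F Psi : 'rV[R]_N -> R).
Context {d} {T : measurableType d} (P : probability T R).
Context (coin : nat -> T -> bool) (fair : fair_coins P coin).
Context (D : set 'rV[R]_N) (M : R) (u : 'rV[R]_N -> R).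
Hypothesis eps_gt0 : 0 < eps.
Hypothesis ballD : forall p, Om p -> eball p eps `<=` D.
Hypothesis D_Om : forall p, D p -> ~ outer_strip Om gamma p -> Om p.
Hypothesis payoff_le : forall p, D p -> `|payoff Om F Psi p| <= M.
Hypothesis u_value : game_value Om gamma eps F Psi P coin u.

Local Notation play := (@play R N).
Local Notation policy := (@policy R N).
Local Notation expected_payoff := (expected_payoff Om gamma F Psi P coin).
Local Notation VI := (VI Om gamma F Psi P coin).
Local Notation VII := (VII Om gamma F Psi P coin).
Local Notation pay := (payoff Om F Psi).
Local Notation strategy := (@strategy R N eps).
Local Notation stay := (fun k (h : history R N k) => h.2).

Lemma value_on_D p : D p ->
  value_I Om gamma eps F Psi P coin p = (u p)%:E /\
  value_II Om gamma eps F Psi P coin p = (u p)%:E.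
Proof.
move=> Dp; apply: u_value; have [|ns] := pselect (outer_strip Om gamma p).
  by right.
by left; exact: D_Om.
Qed.

Lemma expected_payoff_ends_at_once v x tau SI SII :
  (forall w : play, (w 0%N).1 = x -> ends_at Om gamma tau w 0) ->
  expected_payoff v x tau SI SII = (pay x)%:E.
Proof.
move=> e0; rewrite /expected_payoff asboolT; last first.
  by apply: aeW => t; exists 0%N; exact: e0.
rewrite (_ : (fun t => _) = cst (pay x)) ?expectation_cst//.
apply/funext => t /=; rewrite /terminal_position.
by rewrite (@end_timeE _ _ _ _ _ _ 0%N)//; exact: e0.
Qed.

Lemma expected_payoff_le x tau SI SII : stopping_rule tau -> strategy SI ->
  strategy SII -> D x -> (VI x tau SI SII <= M%:E)%E.
Proof.
move=> t_rule sI sII Dx; rewrite /VI.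
rewrite (expected_payoffE fair ballD D_Om payoff_le t_rule sI sII Dx).
case: ifP => [t1|_]; last exact: leNye.
have ap := approximable_payoff ballD D_Om payoff_le t_rule sI sII Dx 0.
have M0 : 0 <= M by exact: le_trans (payoff_le Dx).
rewrite -[leRHS]mule1 -(probability_setT P) -integral_cst//.
apply: le_integral => //.
- exact: (integrable_finitely_approximable fair ap).
- exact: finite_measure_integrable_cst.
move=> t _; rewrite lee_fin /stopped_value; case: asboolP => //.
move=> [n /ends_at_first [k [_ ek nj]]]; rewrite /terminal_position (end_timeE ek nj).
rewrite (le_trans (ler_norm _))// payoff_le//.
exact: (play_stays ballD D_Om sI sII Dx nj).
Qed.

Lemma payoff_le_value p : D p -> pay p <= u p.
Proof.
move=> Dp; rewrite -lee_fin -(value_on_D Dp).1.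
apply: (@le_trans _ _ (ereal_inf
    [set VI p (fun=> 0%N) stay SII | SII in strategy])).
  apply: le_ereal_inf_tmp => _ [SII _ <-].
  by rewrite /VI expected_payoff_ends_at_once// => w _; right.
apply: ereal_sup_ubound; exists (fun=> 0%N, stay) => //; split=> /=.
  exact: stopping_rule_at_once.
exact: strategy_stay.
Qed.

Lemma value_le p : D p -> u p <= M.
Proof.
move=> Dp; rewrite -lee_fin -(value_on_D Dp).1.
apply: ge_ereal_sup => _ [[tau SI] [/= t_rule sI] <-].
apply: le_trans (expected_payoff_le t_rule sI (strategy_stay eps_gt0) Dp).
by apply: ereal_inf_lbound; exists stay => //; exact: strategy_stay.
Qed.

Lemma near_optimal_I SII (e : R) p : strategy SII -> 0 < e -> D p ->
  exists tauSI : (play -> nat) * policy,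
    [/\ stopping_rule tauSI.1, strategy tauSI.2 &
        ((u p - e)%:E <= VII p tauSI.1 tauSI.2 SII)%E].
Proof.
move=> sII e0 Dp.
have : ((u p - e)%:E < ereal_sup
    [set VII p q.1 q.2 SII | q in stopping_rule `*` strategy])%E.
  apply: (@lt_le_trans _ _ (u p)%:E); first by rewrite lte_fin gtrBl.
  by rewrite -(value_on_D Dp).2; apply: ereal_inf_lbound; exists SII.
by move=> /ereal_sup_gt[_ [q [t_rule sI] <-] /ltW lt]; exists q.
Qed.

Lemma near_optimal_II tau SI (e : R) p : stopping_rule tau -> strategy SI ->
  0 < e -> D p ->
  exists SII : policy, strategy SII /\ (VI p tau SI SII <= (u p + e)%:E)%E.
Proof.
move=> t_rule sI e0 Dp.
have : (ereal_inf [set VI p tau SI SII | SII in strategy] < (u p + e)%:E)%E.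
  apply: (@le_lt_trans _ _ (u p)%:E); last by rewrite lte_fin ltrDl.
  rewrite -(value_on_D Dp).1; apply: ereal_sup_ubound.
  by exists (tau, SI).
by move=> /ereal_inf_lt[_ [SII sII <-] /ltW lt]; exists SII.
Qed.

(** Player I moves to [y]; Player II moves to some [z] of her own, where [u] is
    at least [b]. *)
Lemma value_ge_mean x y (b : R) : Om x -> eball x eps y ->
  (forall z, eball x eps z -> b <= u z) -> 2^-1 * (u y + b) <= u x.
Proof.
move=> Ox xy ub; have Dx : D x by apply: (ballD Ox); exact: eball_center.
apply/ler_addgt0Pr => e e0; rewrite -lerBlDr -lee_fin -(value_on_D Dx).2.
apply: le_ereal_inf_tmp => _ [SII sII <-].
pose z : 'rV[R]_N := SII 0%N ([tuple], x : position R N).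
have xz : eball x eps z by have [_] := sII 0%N; apply.
pose s : stage R N := (x, (y, z)).
have sII' : strategy (policy_after s SII) by exact: strategy_after.
have : forall p, exists tauSI : (play -> nat) * policy, D p ->
    [/\ stopping_rule tauSI.1, strategy tauSI.2 &
        ((u p - e)%:E <= VII p tauSI.1 tauSI.2 (policy_after s SII))%E].
  move=> p; have [Dp|nDp] := pselect (D p); last by exists (fun=> 0%N, stay).
  by have [q] := near_optimal_I sII' e0 Dp; exists q.
move=> /choice[K KP].
have Dyz p : [set y; z] p -> D p by move=> [|] ->; exact: (ballD Ox).
have Ky := KP y (Dyz y (or_introl erefl)).
have Kz := KP z (Dyz z (or_intror erefl)).
pose SI := glue_policy x y y z (fun p => (K p).2).
pose tau := glue_rule y z (fun p => (K p).1).
have sI : strategy SI.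
  by apply: strategy_glue => //; [case: Ky|case: Kz].
have t_rule : stopping_rule tau.
  by apply: stopping_rule_glue; [case: Ky|case: Kz].
have SIx : SI 0%N ([tuple], x : position R N) = y by exact: glue_policy_first.
apply: (@le_trans _ _ (VII x tau SI SII)); last first.
  by apply: ereal_sup_ubound; exists (tau, SI).
rewrite /VII (@expected_payoff_first_stage _ _ _ _ _ _ _ _ _ _ _ fair D M ballD
  D_Om payoff_le tau SI SII x (fun p => (K p).1) (fun p => (K p).2)
  (fun=> policy_after s SII)) //; rewrite ?SIx -/z //.
- case: Ky => _ _; case: Kz => _ _; rewrite /VII.
  case: (expected_payoff _ z _ _ _) => [a||];
    case: (expected_payoff _ y _ _ _) => [c||] //=.
  + rewrite !lee_fin => la lc; have bz := ub _ xz; lra.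
  + by rewrite ?gt0_muley ?lte_fin ?invr_gt0 ?leey.
  + by rewrite ?gt0_muley ?lte_fin ?invr_gt0 ?leey.
  + by rewrite ?gt0_muley ?lte_fin ?invr_gt0 ?leey.
- by move=> p /Dyz /KP[].
- by move=> k h hyz; exact: glue_policy_cons.
- by move=> w wyz; exact: glue_rule_cons.
- by right.
Qed.

(** Player II moves to [z]; Player I either stops and gets [Psi x], or moves to
    some [y] of his own, where [u] is at most [b]. *)
Lemma value_le_mean x z (b : R) : Om x -> eball x eps z ->
  (forall y, eball x eps y -> u y <= b) ->
  u x <= Num.max (Psi x) (2^-1 * (b + u z)).
Proof.
move=> Ox xz ub; have Dx : D x by apply: (ballD Ox); exact: eball_center.
apply/ler_addgt0Pr => e e0; rewrite -lee_fin -(value_on_D Dx).1.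
apply: ge_ereal_sup => _ [[tau SI] [/= t_rule sI] <-].
have [tau0|tau_gt0] := stopping_rule_zero x t_rule.
  apply: (@le_trans _ _ (VI x tau SI stay)).
    by apply: ereal_inf_lbound; exists stay => //; exact: strategy_stay.
  rewrite /VI expected_payoff_ends_at_once; last by move=> w wx; right; exact: tau0.
  rewrite lee_fin /payoff mem_set// -[leLHS]addr0 lerD //; last exact: ltW.
  by rewrite le_max lexx.
pose y : 'rV[R]_N := SI 0%N ([tuple], x : position R N).
have xy : eball x eps y by have [_] := sI 0%N; apply.
pose s : stage R N := (x, (y, z)).
have sI' : strategy (policy_after s SI) by exact: strategy_after.
have tau_s w : tau (play_cons s w) != 0%N by exact: tau_gt0.
have t_rule' := stopping_rule_after tau_s t_rule.
have : forall p, exists SII : policy, D p -> strategy SII /\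
    (VI p (rule_after s tau) (policy_after s SI) SII <= (u p + e)%:E)%E.
  move=> p; have [Dp|nDp] := pselect (D p); last by exists stay.
  by have [S] := near_optimal_II t_rule' sI' e0 Dp; exists S.
move=> /choice[K KP].
have Dyz p : [set y; z] p -> D p by move=> [|] ->; exact: (ballD Ox).
have Ky := KP y (Dyz y (or_introl erefl)).
have Kz := KP z (Dyz z (or_intror erefl)).
pose SII := glue_policy x z y z K.
have sII : strategy SII by apply: strategy_glue => //; [case: Ky|case: Kz].
have SIIx : SII 0%N ([tuple], x : position R N) = z by exact: glue_policy_first.
apply: (@le_trans _ _ (VI x tau SI SII)).
  by apply: ereal_inf_lbound; exists SII.
rewrite /VI (@expected_payoff_first_stage _ _ _ _ _ _ _ _ _ _ _ fair D M ballD
  D_Om payoff_le tau SI SII x (fun=> rule_after s tau)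
  (fun=> policy_after s SI) K) //; rewrite ?SIIx -/y //.
- case: Ky => _; case: Kz => _; rewrite /VI.
  case: (expected_payoff _ z _ _ _) => [a||];
    case: (expected_payoff _ y _ _ _) => [c||] //=.
  + rewrite !lee_fin => la lc; have by' := ub _ xy.
    rewrite -lerBlDr le_max; apply/orP; right; lra.
  + by rewrite ?gt0_muleNy ?lte_fin ?invr_gt0 ?leNye.
  + by rewrite ?gt0_muleNy ?lte_fin ?invr_gt0 ?leNye.
  + by rewrite ?gt0_muleNy ?lte_fin ?invr_gt0 ?leNye.
- by move=> p /Dyz /KP[].
- by move=> k h hyz; exact: glue_policy_cons.
- by move=> w _; rewrite /rule_after prednK// lt0n.
- by left.
Qed.

End Value.

Theorem lemma3 (R : realType) (N : nat) (hN : (0 < N)%N)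
    (Om : set 'rV[R]_N) (hOm : bounded_smooth_domain Om)
    (gamma : R) (hgamma : 0 < gamma)
    (F Psi : 'rV[R]_N -> R)
    (hF : lipschitz_in (outer_strip Om gamma) F)
    (hPsi : lipschitz_in setT Psi)
    (hPsiF : forall x, outer_strip Om gamma x -> Psi x <= F x)
    (eps : R) (heps : 0 < eps <= gamma)
    (d : measure_display) (T : measurableType d) (P : probability T R)
    (coin : nat -> T -> bool) (hcoin : fair_coins P coin)
    (u : 'rV[R]_N -> R) (hu : game_value Om gamma eps F Psi P coin u) :
  forall x : 'rV[R]_N, Om x ->
    0 <= u x - 2^-1 * (sup (u @` eball x eps) + inf (u @` eball x eps))
      <= Num.max
           (Psi x - 2^-1 * (sup (Psi @` eball x eps) + inf (Psi @` eball x eps)))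
           0.
Proof.
move=> x Ox; have [oOm _ _ bOm _] := hOm; have /andP[eps0 eps_gamma] := heps.
pose D := fattening Om eps.
have [M payM] := payoff_bounded oOm bOm eps_gamma hF hPsi.
have ballD p : Om p -> eball p eps `<=` D by move=> Op q pq; exists p.
have D_strip p : D p -> ~ Om p -> outer_strip Om gamma p.
  by move=> Dp; exact: fattening_outer_strip Dp.
have D_Om p : D p -> ~ outer_strip Om gamma p -> Om p.
  by move=> Dp ns; apply: contrapT => /(D_strip p Dp).
have xD := ballD _ Ox; have xx : eball x eps x by exact: eball_center.
have Psi_u p : eball x eps p -> Psi p <= u p.
  move=> /xD Dp; apply: le_trans (payoff_le_value eps0 D_Om hu Dp).
  rewrite /payoff; case: ifPn => // ; rewrite notin_setE => /(D_strip p Dp).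
  exact: hPsiF.
have [B DB] := fattening_coord eps bOm.
have [MP PsiM] := lipschitz_in_bounded hPsi (@subsetT _ _) DB.
have u_ub : has_ubound (u @` eball x eps).
  exists M => _ [p /xD Dp <-].
  exact: (value_le hcoin eps0 ballD D_Om payM hu Dp).
have Psi_lb : has_lbound (Psi @` eball x eps).
  exists (- MP) => _ [p /xD/PsiM + <-]; rewrite ler_norml => /andP[]//.
have u_lb : has_lbound (u @` eball x eps).
  have [m Pm] := Psi_lb; exists m => _ [p xp <-].
  by apply: le_trans (Psi_u p xp); apply: Pm; exists p.
set Su := sup (u @` _); set Iu := inf (u @` _).
set SP := sup (Psi @` _); set IP := inf (Psi @` _).
have u_Su p : eball x eps p -> u p <= Su.
  by move=> xp; apply: ub_le_sup => //; exists p.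
have Iu_u p : eball x eps p -> Iu <= u p.
  by move=> xp; apply: ge_inf => //; exists p.
have SP_Su : SP <= Su.
  apply: ge_sup; first by exists (Psi x), x.
  by move=> _ [p xp <-]; exact: le_trans (Psi_u p xp) (u_Su p xp).
have IP_Iu : IP <= Iu.
  apply: lb_le_inf; first by exists (u x), x.
  move=> _ [p xp <-]; apply: le_trans (Psi_u p xp).
  by apply: ge_inf => //; exists p.
have lower : 2^-1 * (Su + Iu) <= u x.
  suff : Su <= 2 * u x - Iu by lra.
  apply: ge_sup; first by exists (u x), x.
  move=> _ [y xy <-].
  have := value_ge_mean hcoin eps0 ballD D_Om payM hu Ox xy Iu_u; lra.
have upper : u x <= Psi x \/ u x <= 2^-1 * (Su + Iu).
  have [|Psi_ux] := leP (u x) (Psi x); [by left|right].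
  suff : 2 * u x - Su <= Iu by lra.
  apply: lb_le_inf; first by exists (u x), x.
  move=> _ [z xz <-].
  have := value_le_mean hcoin eps0 ballD D_Om payM hu Ox xz u_Su.
  by rewrite le_max leNgt Psi_ux /=; lra.
apply/andP; split; first by rewrite subr_ge0.
rewrite le_max; apply/orP; case: upper => u_le; [left|right]; lra.
Qed.
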